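(* Let $n\ge 1$ be an integer and $0<s\le 1$. Then for any $u,v\in\mathscr S(\mathbb R^n)$ we have $$\int_{\mathbb R^n}u(x)\,(-\Delta)^s v(x)\,dx=\int_{\mathbb R^n}(-\Delta)^s u(x)\,v(x)\,dx .$$
   Context: $\mathscr S(\mathbb R^n)$ is the Schwartz space. For $0<s<1$ and $u\in\mathscr S(\mathbb R^n)$, $$(-\Delta)^s u(x)=\frac{\gamma(n,s)}{2}\int_{\mathbb R^n}\frac{2u(x)-u(x+y)-u(x-y)}{|y|^{n+2s}}\,dy,\qquad \gamma(n,s)=\frac{s\,2^{2s}\,\Gamma\left(\frac{n+2s}{2}\right)}{\pi^{n/2}\,\Gamma(1-s)}.$$ For $s=1$, $(-\Delta)^1=-\Delta=-\sum_{k=1}^n\partial^2/\partial x_k^2$. *)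

(* Defs.v *)
From HB Require Import structures.
From mathcomp Require Import all_boot all_order all_algebra.
From mathcomp Require Import all_classical all_reals all_analysis.
From mathcomp Require Import complex.

Set Implicit Arguments.
Unset Strict Implicit.
Unset Printing Implicit Defensive.
Import Order.TTheory GRing.Theory Num.Theory.
Import numFieldNormedType.Exports.

Local Open Scope classical_set_scope.
Local Open Scope ring_scope.
Local Open Scope complex_scope.

Definition measure_rV_display : measure_display -> measure_display.
Proof. exact. Qed.

(* The product sigma-algebra on R^n, generated by the coordinate maps. *)
Section measurable_rV.
Context {d} {T : measurableType d} {n : nat}.

Let coord : 'I_n -> 'rV[T]_n -> T := fun i x => x ord0 i.

Let rV_set0 : g_sigma_preimage coord set0.
Proof. exact: sigma_algebra0. Qed.

Let rV_setC A : g_sigma_preimage coord A -> g_sigma_preimage coord (~` A).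
Proof. exact: sigma_algebraC. Qed.

Let rV_bigcup (F : _^nat) : (forall i, g_sigma_preimage coord (F i)) ->
  g_sigma_preimage coord (\bigcup_i (F i)).
Proof. exact: sigma_algebra_bigcup. Qed.

HB.instance Definition _ := @isMeasurable.Build (measure_rV_display d)
  'rV[T]_n (g_sigma_preimage coord) rV_set0 rV_setC rV_bigcup.

Lemma measurable_coord (i : 'I_n) :
  measurable_fun [set: 'rV[T]_n] (fun x => x ord0 i).
Proof.
move=> _ Y mY; rewrite setTI; apply: sub_sigma_algebra => /=.
rewrite -bigcup_seq/=; exists i => /=; first by rewrite mem_index_enum.
by exists Y => //; rewrite setTI.
Qed.

End measurable_rV.

Section measurable_fun_rV.
Context d1 d2 (T1 : measurableType d1) (T2 : measurableType d2).

Lemma measurable_fun_rVP n (f : T1 -> 'rV[T2]_n) :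
  (forall i, measurable_fun [set: T1] (fun x => f x ord0 i)) ->
  measurable_fun [set: T1] f.
Proof.
move=> mf; suff : g_sigma_preimage (fun i => (fun x : 'rV[T2]_n => x ord0 i) \o f)
    `<=` measurable.
  rewrite g_sigma_preimage_comp => prefS _ A mA.
  by apply: prefS; exists A.
apply: smallest_sub; first exact: sigma_algebra_measurable.
case: n => [|n] in f mf *; first by rewrite big_ord0.
rewrite -bigcup_mkord_ord; apply: bigcup_sub => i Ii.
by move=> A [B mB <-]; exact: mf.
Qed.

End measurable_fun_rV.

Section lebesgue_rV.
Context {R : realType}.

Definition consrV n (p : R * 'rV[R]_n) : 'rV[R]_n.+1 := row_mx p.1%:M p.2.
Definition unconsrV n (x : 'rV[R]_n.+1) : R * 'rV[R]_n :=
  (x ord0 ord0, \row_i x ord0 (lift ord0 i)).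

Lemma consrV0 n (p : R * 'rV[R]_n) : consrV p ord0 ord0 = p.1.
Proof.
have -> : (ord0 : 'I_n.+1) = lshift n (ord0 : 'I_1) by exact/val_inj.
by rewrite /consrV (@row_mxEl _ 1 1 n) mxE eqxx mulr1n.
Qed.

Lemma consrVS n (p : R * 'rV[R]_n) i : consrV p ord0 (lift ord0 i) = p.2 ord0 i.
Proof.
have -> : lift ord0 i = rshift 1 i by exact/val_inj.
by rewrite /consrV (@row_mxEr _ 1 1 n).
Qed.

Lemma consrVK n : cancel (@consrV n) (@unconsrV n).
Proof.
move=> p; rewrite /unconsrV consrV0 [RHS]surjective_pairing; congr (_, _).
by apply/rowP => i; rewrite mxE consrVS.
Qed.

Lemma measurable_consrV n : measurable_fun [set: R * 'rV[R]_n] (@consrV n).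
Proof.
apply: measurable_fun_rVP => i; have [j ->|->] := unliftP ord0 i.
  under eq_fun do rewrite consrVS.
  exact: (measurableT_comp (measurable_coord j) measurable_snd).
by under eq_fun do rewrite consrV0; exact: measurable_fst.
Qed.

Lemma measurable_unconsrV n : measurable_fun [set: 'rV[R]_n.+1] (@unconsrV n).
Proof.
apply/measurable_fun_pair => /=; first exact: measurable_coord.
apply: measurable_fun_rVP => i; under eq_fun do rewrite mxE.
exact: measurable_coord.
Qed.

Section step.
Variables (n : nat) (mu : {sigma_finite_measure set 'rV[R]_n -> \bar R}).

Definition lebesgue_rVS : set 'rV[R]_n.+1 -> \bar R :=
  pushforward (lebesgue_measure \x mu)%E (@consrV n).

Let lebesgue_rVS0 : lebesgue_rVS set0 = 0%E.
Proof. by rewrite /lebesgue_rVS /pushforward preimage_set0 measure0. Qed.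

Let lebesgue_rVS_ge0 A : (0 <= lebesgue_rVS A)%E.
Proof. by rewrite /lebesgue_rVS /pushforward measure_ge0. Qed.

Let lebesgue_rVS_sigma_additive : semi_sigma_additive lebesgue_rVS.
Proof.
exact: (@measure_semi_sigma_additive _ _ _
  (measure_function_pushforward__canonical__measure_function_Measure
    (lebesgue_measure \x mu)%E (@measurable_consrV n))).
Qed.

HB.instance Definition _ := isMeasure.Build _ _ _ lebesgue_rVS
  lebesgue_rVS0 lebesgue_rVS_ge0 lebesgue_rVS_sigma_additive.

Let lebesgue_rVS_sigma_finite : sigma_finite [set: 'rV[R]_n.+1] lebesgue_rVS.
Proof.
have /sigma_finiteP[F [TF ndF Foo]] := sigma_finiteT (@lebesgue_measure R).
have /sigma_finiteP[G [TG ndG Goo]] := sigma_finiteT mu.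
exists (fun k => @unconsrV n @^-1` (F k `*` G k)).
  apply/esym; rewrite -subTset => x _; rewrite -preimage_bigcup /=.
  have [i _ Fi] : (\bigcup_k F k) (unconsrV x).1 by rewrite -TF.
  have [j _ Gj] : (\bigcup_k G k) (unconsrV x).2 by rewrite -TG.
  exists (maxn i j) => //; split.
  - by move: Fi; exact/subsetPset/ndF/leq_maxl.
  - by move: Gj; exact/subsetPset/ndG/leq_maxr.
move=> k; have [mF Fk] := Foo k; have [mG Gk] := Goo k; split.
  rewrite -[X in measurable X]setTI; apply: measurable_unconsrV => //.
  exact: measurableX.
rewrite /lebesgue_rVS /pushforward -comp_preimage.
have -> : @unconsrV n \o @consrV n = id by apply/funext => p; exact: consrVK.
rewrite preimage_id product_measure1E//.
by rewrite lte_mul_pinfty// ge0_fin_numE.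
Qed.

HB.instance Definition _ := Measure_isSigmaFinite.Build _ _ _ lebesgue_rVS
  lebesgue_rVS_sigma_finite.

End step.

Fixpoint lebesgue_rV n : {sigma_finite_measure set 'rV[R]_n -> \bar R} :=
  if n is n'.+1 then lebesgue_rVS (lebesgue_rV n') else dirac (0 : 'rV[R]_0).

(* This characterizes n-dimensional Lebesgue measure. *)
Lemma lebesgue_rV_box n (A : 'I_n -> set R) : (forall i, measurable (A i)) ->
  lebesgue_rV n [set x | forall i, A i (x ord0 i)] =
  (\prod_(i < n) lebesgue_measure (A i))%E.
Proof.
elim: n A => [|n IHn] A mA.
  rewrite big_ord0 (_ : [set _ | _] = setT) /= ?diracT//.
  by rewrite -subTset => x _ [].
have mB : measurable [set x : 'rV[R]_n | forall i, A (lift ord0 i) (x ord0 i)].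
  rewrite (_ : [set _ | _] = \bigcap_(i in [set: 'I_n])
      ((fun x : 'rV[R]_n => x ord0 i) @^-1` A (lift ord0 i))); last first.
    by apply/seteqP; split=> x /= Ax i; [move=> _|]; exact: Ax.
  apply: fin_bigcap_measurable => [|i _]; first exact: finite_finset.
  by rewrite -[X in measurable X]setTI; exact: measurable_coord.
rewrite big_ord_recl -IHn//= /lebesgue_rVS /pushforward -product_measure1E//.
congr (product_measure1 _ _ _); apply/seteqP; split=> [[a x] /= Ax|[a x] /= [Aa Ax] i].
  split=> [|i]; first by have := Ax ord0; rewrite consrV0.
  by have := Ax (lift ord0 i); rewrite consrVS.
  by have [j ->|->] := unliftP ord0 i; rewrite ?consrV0 ?consrVS.
exact: mA.
Qed.
End lebesgue_rV.

Section complex_functions.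
Context {R : realType}.

Definition cintegral d (T : measurableType d) (mu : {measure set T -> \bar R})
    (f : T -> R[i]) : R[i] :=
  (\int[mu]_x complex.Re (f x))%R +i* (\int[mu]_x complex.Im (f x))%R.

Variable n : nat.
Implicit Types (u : 'rV[R]_n -> R[i]) (x y : 'rV[R]_n) (i : 'I_n).

Definition basisv i : 'rV[R]_n := delta_mx ord0 i.

Definition cpartial i u : 'rV[R]_n -> R[i] := fun x =>
  'D_(basisv i) (@complex.Re R \o u) x +i* 'D_(basisv i) (@complex.Im R \o u) x.

(* Iterated partial derivative along an arbitrary word of directions: on
   smooth functions these are the derivatives of multi-index order, without
   relying on the symmetry of mixed derivatives. *)
Definition cpartials (s : seq 'I_n) u : 'rV[R]_n -> R[i] := foldr cpartial u s.

Definition ccontinuous u :=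
  continuous (@complex.Re R \o u) /\ continuous (@complex.Im R \o u).

Definition cpartial_derivable i u := forall x,
  derivable (@complex.Re R \o u) x (basisv i) /\
  derivable (@complex.Im R \o u) x (basisv i).

Definition smooth u := forall s : seq 'I_n,
  ccontinuous (cpartials s u) /\
  forall i, cpartial_derivable i (cpartials s u).

Definition monomial (a : 'I_n -> nat) x : R := \prod_(i < n) x ord0 i ^+ a i.

Definition schwartz u := smooth u /\
  forall (a : 'I_n -> nat) (s : seq 'I_n), exists M : R, forall x,
    `|(monomial a x)%:C * cpartials s u x| <= M%:C.

(* Euclidean norm; the library norm on 'rV[R]_n is the sup norm. *)
Definition enorm x : R := Num.sqrt (\sum_(i < n) x ord0 i ^+ 2).

Definition Gamma (z : R) : R :=
  \int[lebesgue_measure]_(t in `]0%R, +oo[%classic) (t `^ (z - 1) * expR (- t)).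

Definition fracLaplace_const (s : R) : R :=
  s * 2 `^ (2 * s) * Gamma ((n%:R + 2 * s) / 2) /
  (pi `^ (n%:R / 2) * Gamma (1 - s)).

Definition laplace u : 'rV[R]_n -> R[i] := fun x =>
  \sum_(k < n) cpartial k (cpartial k u) x.

(* (-Delta)^s for 0 < s <= 1. The integrand takes the value 0 at y = 0. *)
Definition fracLaplace (s : R) u : 'rV[R]_n -> R[i] := fun x =>
  if s == 1 then - laplace u x
  else (fracLaplace_const s / 2)%:C *
    cintegral (lebesgue_rV n) (fun y =>
      (2 * u x - u (x + y) - u (x - y)) / (enorm y `^ (n%:R + 2 * s))%:C).

End complex_functions.

(* Main.v *)
Require Import Defs.
From HB Require Import structures.
From mathcomp Require Import all_boot all_order all_algebra.
From mathcomp Require Import all_classical all_reals all_analysis.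
From mathcomp Require Import complex measurable_realfun lra ring.
Import Order.TTheory GRing.Theory Num.Theory.
Import numFieldNormedType.Exports.
Set Implicit Arguments.
Unset Strict Implicit.
Unset Printing Implicit Defensive.
Local Open Scope classical_set_scope.
Local Open Scope ring_scope.

(* Taking real and imaginary parts reduces everything to real Schwartz functions
   f and g. Translation invariance gives
   \int f(x) g(x + y) dx = \int f(x - y) g(x) dx, and the two cases apply it thus.
   For s < 1, multiply the symmetric second difference of g by f: for fixed y its
   integral over x is symmetric in f and g, and Fubini exchanges the integrals.
   Integrability holds because the second difference is at most
   C min(1, |y|^2), and min(1, |y|^2) |y|^(-n-2s) is integrable since 0 < s < 1;
   this is checked on dyadic cubes rather than in polar coordinates.
   For s = 1, apply the translation identity to difference quotients and pass to
   the limit by dominated convergence, which gives integration by parts. *)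

(** * Measurability and translation invariance on R^n *)

Section measurability.
Context {R : realType} {n : nat}.
Implicit Types (x y : 'rV[R]_n) (O : set 'rV[R]_n).

Lemma rV_norm_leP x r : 0 <= r -> `|x| <= r <-> forall i, `|x ord0 i| <= r.
Proof.
move=> r0; rewrite [`|x|]/Num.norm/= mx_normrE; split.
  move=> /bigmax_leP[_ xr] i; exact: (xr (ord0, i)).
by move=> xr; apply/bigmax_leP; split=> // -[i j] _ /=; rewrite ord1.
Qed.

Lemma rV_coord_le x i : `|x ord0 i| <= `|x|.
Proof. by move: i; apply/rV_norm_leP. Qed.

Lemma measurable_rV_box (A : 'I_n -> set R) : (forall i, measurable (A i)) ->
  measurable [set x : 'rV[R]_n | forall i, A i (x ord0 i)].
Proof.
move=> mA; rewrite (_ : [set _ | _] = \bigcap_(i in [set: 'I_n])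
      ((fun x : 'rV[R]_n => x ord0 i) @^-1` A i)); last first.
  by apply/seteqP; split=> x /= Ax i; [move=> _|]; exact: Ax.
apply: fin_bigcap_measurable => [|i _]; first exact: finite_finset.
by rewrite -[X in measurable X]setTI; exact: measurable_coord.
Qed.

(** The sigma-algebra is generated by the coordinates, so [O] has to be a countable union of boxes:
    those with rational centre and radius 1/(k+1) that lie inside [O] exhaust it. *)
Lemma open_measurable_rV O : open O -> measurable O.
Proof.
move=> oO.
pose B (p : 'rV[rat]_n * nat) : set 'rV[R]_n :=
  [set x | forall i, ball (ratr (p.1 ord0 i) : R) p.2.+1%:R^-1 (x ord0 i)].
suff -> : O = \bigcup_p (if `[< B p `<=` O >] then B p else set0).
  apply: countable_bigcupT_measurable => [|p]; first exact: countableP.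
  case: ifP => // _; apply: (@measurable_rV_box
    (fun i => ball (ratr (p.1 ord0 i) : R) p.2.+1%:R^-1)) => i.
  exact: (measurable_realfun.open_measurable (ball_open _ _)).
apply/seteqP; split=> [x Ox|x [p _]]; last first.
  by case: asboolP => // BO Bx; exact: BO.
have /nbhs_ballP[e /= e0 xeO] : nbhs x O by exact: open_nbhs_nbhs.
(* Half of [e], since two points of the box are compared through its rational centre and the two
   errors add up. *)
have [k] : exists k, 0 + k.+1%:R^-1 < e / 2.
  by apply: ltr_add_invr; rewrite divr_gt0.
rewrite add0r => ke.
have q_ i : exists q : rat, ball (ratr q : R) k.+1%:R^-1 (x ord0 i).
  have /rat_in_itvoo[q] : x ord0 i - k.+1%:R^-1 < x ord0 i + k.+1%:R^-1.
    by rewrite ltrD2l gtrN// invr_gt0.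
  rewrite in_itv/= => /andP[q1 q2]; exists q.
  by rewrite /ball/= ltr_distlC ltrBlDr q2 -ltrBlDr q1.
have [q qP] := choice q_.
exists (\row_i q i, k) => //; case: asboolP => [_ i|]; first by rewrite mxE.
case=> y By; apply: xeO; split=> // i j; rewrite ord1.
have := By j; have := qP j; rewrite mxE /ball/= => qx qy.
rewrite (_ : x ord0 j - y ord0 j =
  (ratr (q j) - y ord0 j) - (ratr (q j) - x ord0 j)); last by lra.
by apply: (le_lt_trans (ler_normB _ _)); rewrite [e]splitr ltrD// (lt_trans _ ke).
Qed.

Lemma continuous_measurable_rV (f : 'rV[R]_n -> R) :
  continuous f -> measurable_fun [set: 'rV[R]_n] f.
Proof.
move=> cf; apply: (measurability _ (RGenOpens.measurableE R)).
move=> _ [_ [a [b ->] <-]].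
rewrite setTI; apply: open_measurable_rV => /=.
by move/continuousP : cf; apply; exact: interval_open.
Qed.

End measurability.

Section translation.
Context {R : realType}.

Lemma measurable_rV_add n :
  measurable_fun setT (fun p : 'rV[R]_n * 'rV[R]_n => p.1 + p.2).
Proof.
apply: measurable_fun_rVP => i; under eq_fun do rewrite mxE.
apply: measurable_funD.
  exact: (measurableT_comp (measurable_coord i) measurable_fst).
exact: (measurableT_comp (measurable_coord i) measurable_snd).
Qed.

Lemma measurable_rV_sub n :
  measurable_fun setT (fun p : 'rV[R]_n * 'rV[R]_n => p.1 - p.2).
Proof.
apply: measurable_fun_rVP => i; under eq_fun do rewrite !mxE.
apply: measurable_funB.
  exact: (measurableT_comp (measurable_coord i) measurable_fst).
exact: (measurableT_comp (measurable_coord i) measurable_snd).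
Qed.

Lemma measurable_rV_shift n (c : 'rV[R]_n) :
  measurable_fun setT (fun x : 'rV[R]_n => x + c).
Proof.
apply: measurable_fun_rVP => i; under eq_fun do rewrite mxE.
by apply: measurable_funD; [exact: measurable_coord|exact: measurable_cst].
Qed.

(** Lebesgue measure is determined by its values on the intervals []a, b]], and a shift preserves
    their length. *)
Lemma lebesgue_measure_shift (c : R) (A : set R) : measurable A ->
  lebesgue_measure ((fun x => x + c) @^-1` A) = lebesgue_measure A.
Proof.
move=> mA.
have mc : measurable_fun setT ((fun x => x + c) : _ -> measurableTypeR R).
  by apply: measurable_funD => //; exact: measurable_cst.
apply/esym.
rewrite (@lebesgue_measure_unique R (pushforward lebesgue_measure
  ((fun x => x + c) : _ -> measurableTypeR R)))//.
move=> _ [[a b]] _ <- /=.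
have -> : pushforward lebesgue_measure
    ((fun x => x + c) : _ -> measurableTypeR R) `]a, b] =
    lebesgue_measure `]a - c, b - c]%classic.
  congr (lebesgue_measure _).
  by apply/seteqP; split=> x /=; rewrite !in_itv/= ltrBlDr lerBrDr.
rewrite !lebesgue_measure_itv/= !lte_fin ltrD2r.
by case: ifP => // _; congr EFin; lra.
Qed.

Lemma consrVD n (p q : R * 'rV[R]_n) :
  consrV (p.1 + q.1, p.2 + q.2) = consrV p + consrV q.
Proof.
apply/rowP => i; rewrite [RHS]mxE; have [j ->|->] := unliftP ord0 i.
  by rewrite !consrVS mxE.
by rewrite !consrV0.
Qed.

Lemma unconsrVK n : cancel (@unconsrV R n) (@consrV R n).
Proof.
move=> x; apply/rowP => i; have [j ->|->] := unliftP ord0 i.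
  by rewrite consrVS mxE.
by rewrite consrV0.
Qed.

(** Induction on the dimension: through [consrV] a shift of R^(n+1) is a shift of R times a shift of
    R^n. It preserves the measure of rectangles, so uniqueness of the product measure applies. *)
Lemma lebesgue_rV_shift n (c : 'rV[R]_n) (A : set 'rV[R]_n) : measurable A ->
  lebesgue_rV n ((fun x => x + c) @^-1` A) = lebesgue_rV n A.
Proof.
elim: n c A => [|n IHn] c A mA.
  congr (lebesgue_rV 0 _).
  by apply/seteqP; split=> x /=; rewrite (_ : x + c = x)//; apply/rowP => -[].
rewrite /= /lebesgue_rVS /pushforward.
pose sh (p : measurableTypeR R * 'rV[R]_n) : measurableTypeR R * 'rV[R]_n :=
  (p.1 + (unconsrV c).1, p.2 + (unconsrV c).2).
have msh : measurable_fun setT sh.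
  apply: measurable_fun_pair.
    by apply: measurable_funD => //; exact: measurable_fst.
  exact: (measurableT_comp (measurable_rV_shift (unconsrV c).2) measurable_snd).
have mB : measurable (@consrV R n @^-1` A).
  by rewrite -[X in measurable X]setTI; exact: measurable_consrV.
(* The product measure pushed forward along [sh] is identified with the product measure itself,
   leaving only rectangles to check. *)
rewrite [RHS](@product_measure_unique _ _ _ _ _ _ _
  (pushforward (lebesgue_measure \x lebesgue_rV n)%E sh))//.
  rewrite /pushforward; congr (product_measure1 _ _ _).
  by apply/seteqP; split=> p /=; rewrite consrVD unconsrVK.
move=> B C mB' mC; rewrite /pushforward.
transitivity ((lebesgue_measure \x lebesgue_rV n)%E
  (((fun x => x + (unconsrV c).1) @^-1` B) `*`
   ((fun x => x + (unconsrV c).2) @^-1` C))); first by [].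
rewrite product_measure1E.
- congr (_ * _)%E; [exact: lebesgue_measure_shift|exact: IHn].
- rewrite -[X in measurable X]setTI.
  by apply: (measurable_funD (@measurable_id _ _ setT) (measurable_cst _)).
- rewrite -[X in measurable X]setTI; exact: measurable_rV_shift.
Qed.

Lemma ge0_integral_rV_shift n (c : 'rV[R]_n) (f : 'rV[R]_n -> \bar R) :
  measurable_fun setT f -> (forall x, 0 <= f x)%E ->
  (\int[lebesgue_rV n]_x f (x + c)%R = \int[lebesgue_rV n]_x f x)%E.
Proof.
move=> mf f0; have mc := measurable_rV_shift c.
rewrite -[LHS](@ge0_integral_pushforward _ _ _ _ _ _ mc _ setT)//.
by apply: eq_measure_integral => A mA _; exact: lebesgue_rV_shift.
Qed.

Lemma integrable_rV_shift n (c : 'rV[R]_n) (f : 'rV[R]_n -> \bar R) :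
  (lebesgue_rV n).-integrable setT f ->
  (lebesgue_rV n).-integrable setT (fun x => f (x + c)).
Proof.
move=> /integrableP[mf fi]; apply/integrableP; split.
  exact: (measurableT_comp mf (measurable_rV_shift c)).
rewrite (@ge0_integral_rV_shift _ c (fun x => `|f x|%E))//.
exact: measurableT_comp.
Qed.

Lemma integral_rV_shift n (c : 'rV[R]_n) (f : 'rV[R]_n -> \bar R) :
  measurable_fun setT f ->
  (\int[lebesgue_rV n]_x f (x + c)%R = \int[lebesgue_rV n]_x f x)%E.
Proof.
move=> mf; rewrite integralE [RHS]integralE; congr (_ - _)%E.
  rewrite -[RHS](@ge0_integral_rV_shift _ c f^\+%E)//.
    by apply: eq_integral => x _; rewrite !funeposE.
  exact: measurable_funepos.
rewrite -[RHS](@ge0_integral_rV_shift _ c f^\-%E)//.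
  by apply: eq_integral => x _; rewrite !funenegE.
exact: measurable_funeneg.
Qed.

End translation.

(** * Dyadic integrability test *)

Section dyadic.
Context {R : realType} {n : nat}.

(* The norm of 'rV[R]_n is the sup norm, so this closed ball is a cube. *)
Definition cube (r : R) : set 'rV[R]_n := [set x | `|x| <= r].

Lemma cubeE r : 0 <= r ->
  cube r = [set x | forall i, (fun=> `[- r, r]%classic) i (x ord0 i)].
Proof.
move=> r0; apply/seteqP; split=> x; rewrite /cube/=.
  move/(rV_norm_leP _ r0) => xr i; rewrite in_itv/= -ler_norml; exact: xr.
move=> xr; apply/(rV_norm_leP _ r0) => i.
by have := xr i; rewrite in_itv/= -ler_norml.
Qed.

Lemma measurable_cube r : 0 <= r -> measurable (cube r).
Proof.
move=> r0; rewrite cubeE//.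
apply: (@measurable_rV_box _ _ (fun=> `[- r, r]%classic)) => _.
exact: measurable_itv.
Qed.

Lemma lebesgue_rV_cube r : 0 <= r ->
  lebesgue_rV n (cube r) = ((2 * r) ^+ n)%:E.
Proof.
move=> r0; rewrite cubeE// (@lebesgue_rV_box _ _ (fun=> `[- r, r]%classic))//.
under eq_bigr do rewrite lebesgue_measure_itv/= lte_fin.
rewrite (eq_bigr (fun=> (2 * r)%:E)); last first.
  move=> i _; case: ifPn => [_|]; first by rewrite -EFinD; congr EFin; lra.
  by rewrite -leNgt => rr; congr EFin; lra.
by rewrite prodEFin prodr_const card_ord.
Qed.

(** [w] is dominated by the sum over k of [c k] times the indicator of [cube (r k)]. The k-th term
    has integral [c k * (2 * r k) ^+ n], so the total is at most the geometric sum [C / (1 - q)].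
    Covering is asked only where [w] is nonzero, which suits weights cut off by an indicator. *)
Lemma integrable_dyadic (w : 'rV[R]_n -> R) (c r : nat -> R) (C q : R) :
  measurable_fun setT w -> (forall x, 0 <= w x) ->
  (forall k, 0 <= c k) -> (forall k, 0 <= r k) -> 0 < q -> q < 1 ->
  (forall k, c k * (2 * r k) ^+ n <= C * q ^+ k) ->
  (forall x, w x != 0 -> exists2 k, `|x| <= r k & w x <= c k) ->
  (lebesgue_rV n).-integrable setT (EFin \o w).
Proof.
move=> mw w0 c0 r0 q0 q1 crq wcr; apply/integrableP; split.
  exact/measurable_EFinP.
have C0 : 0 <= C.
  have := crq 0; rewrite expr0 mulr1; apply: le_trans.
  by rewrite mulr_ge0// exprn_ge0// mulr_ge0.
pose g k (x : 'rV[R]_n) := ((c k)%:E * (\1_(cube (r k)) x)%:E)%E.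
have g0 k x : (0 <= g k x)%E by rewrite mule_ge0// lee_fin.
have mg k : measurable_fun setT (g k).
  apply/measurable_EFinP; apply: measurable_funM => //; apply: measurable_indic.
  exact: measurable_cube.
apply: (@le_lt_trans _ _ (\int[lebesgue_rV n]_x \sum_(0 <= k <oo) g k x)%E).
  apply: ge0_le_integral => //.
  - by apply/measurableT_comp => //; exact/measurable_EFinP.
  - exact: (@ge0_emeasurable_sum _ _ _ setT g xpredT).
  - move=> x _; rewrite /= ger0_norm//.
    have [->|/wcr[k xk wk]] := eqVneq (w x) 0; first exact: nneseries_ge0.
    (* The single term k already dominates [w x]; the others are nonnegative. *)
    apply: (@le_trans _ _ (g k x)).
      by rewrite /g indicE mem_set// mule1 lee_fin.
    rewrite (@nneseriesD1 _ _ k)//.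
    by rewrite leeDl// nneseries_ge0.
rewrite integral_nneseries//.
apply: (@le_lt_trans _ _ (C / (1 - q))%:E); last by rewrite ltry.
apply: lime_le.
  by apply: is_cvg_nneseries => k _ _; exact: integral_ge0.
apply: nearW => N.
rewrite (eq_bigr (fun k => (c k * (2 * r k) ^+ n)%:E)); last first.
  move=> k _; rewrite /g ge0_integralZl_EFin//; last first.
    by apply/measurable_EFinP; exact: (measurable_indic (measurable_cube _)).
  rewrite integral_indic ?setIT//; last exact: measurable_cube.
  by rewrite EFinM; congr (_ * _)%E; exact: lebesgue_rV_cube.
rewrite sumEFin lee_fin (le_trans _ (geometric_le_lim N C0 q0 _))//.
  by apply: ler_sum => k _; exact: crq.
by rewrite ger0_norm// ltW.
Qed.

End dyadic.

(** * Power weights inside and outside the unit cube *)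

Section weights.
Context {R : realType}.

Lemma dyadic_floor (t : R) : 1 <= t -> exists k, 2 ^+ k <= t <= 2 ^+ k.+1.
Proof.
move=> t1.
have ex : exists k, t < 2 ^+ k.
  by exists (Num.Def.archi_bound t); exact: upper_nthrootP.
(* The least exponent is positive because [2 ^+ 0 <= t]; its predecessor gives the lower bound. *)
have := ex_minnP ex; case=> -[|k] tk kmin.
  by move: tk; rewrite expr0 ltNge t1.
exists k; rewrite (ltW tk) andbT leNgt; apply/negP => /kmin.
by rewrite ltnn.
Qed.

Lemma powR_exprn (a p : R) k : 0 <= a -> (a ^+ k) `^ p = (a `^ p) ^+ k.
Proof.
by move=> a0; rewrite -powR_mulrn// powRAC powR_mulrn// powR_ge0.
Qed.

Lemma ler_powRl (a b p : R) : 0 <= a -> 0 <= p -> a <= b -> a `^ p <= b `^ p.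
Proof.
by move=> a0 p0 ab; apply: ge0_ler_powR => //; rewrite nnegrE// (le_trans a0).
Qed.

Lemma invr_powR (a p : R) : 0 <= a -> (a `^ p)^-1 = a^-1 `^ p.
Proof. by move=> a0; rewrite -powRN -powR_inv1// -powRrM mulN1r. Qed.

Variable n : nat.

Lemma measurable_rV_norm : measurable_fun setT (fun x : 'rV[R]_n => `|x|).
Proof. by apply: continuous_measurable_rV => x; exact: norm_continuous. Qed.

Lemma measurable_norm_powR (p : R) :
  measurable_fun setT (fun x : 'rV[R]_n => (`|x| `^ p)^-1).
Proof.
under eq_fun do rewrite -powRN.
exact: (measurableT_comp (measurable_powR (- p)) measurable_rV_norm).
Qed.

(** Majorant away from the origin, where a second difference is merely bounded and only the power
    decays. *)
Definition outer_weight (p : R) (x : 'rV[R]_n) : R :=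
  \1_(~` cube 1) x * (`|x| `^ p)^-1.

(** Majorant near the origin; the extra factor |x|^2 records that a second difference vanishes
    quadratically. *)
Definition inner_weight (p : R) (x : 'rV[R]_n) : R :=
  \1_(cube 1) x * (`|x| ^+ 2 * (`|x| `^ p)^-1).

Lemma measurable_outer_weight p : measurable_fun setT (outer_weight p).
Proof.
apply: measurable_funM; last exact: measurable_norm_powR.
by apply: measurable_indic; apply: measurableC; exact: (measurable_cube ler01).
Qed.

Lemma measurable_inner_weight p : measurable_fun setT (inner_weight p).
Proof.
apply: measurable_funM.
  by apply: measurable_indic; exact: (measurable_cube ler01).
apply: measurable_funM; last exact: measurable_norm_powR.
by apply: measurable_funX; exact: measurable_rV_norm.
Qed.

Lemma outer_weight_ge0 p x : 0 <= outer_weight p x.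
Proof. by rewrite mulr_ge0// invr_ge0 powR_ge0. Qed.

Lemma inner_weight_ge0 p x : 0 <= inner_weight p x.
Proof. by rewrite mulr_ge0// mulr_ge0 ?exprn_ge0// invr_ge0 powR_ge0. Qed.

Lemma integrable_outer_weight (p : R) : n%:R < p ->
  (lebesgue_rV n).-integrable setT (EFin \o outer_weight p).
Proof.
move=> np; have p0 : 0 < p by rewrite (le_lt_trans _ np).
have P0 : 0 < 2 `^ p by rewrite powR_gt0.
(* On the shell 2^k <= |x| <= 2^(k+1) the weight is at most 2^(-pk), and the enclosing cube has
   measure (4 * 2^k)^n. The ratio 2^(n-p) is below 1 because p > n. *)
apply: (@integrable_dyadic _ _ _ (fun k => (2 `^ p) ^- k) (fun k => 2 ^+ k.+1)
  (4 ^+ n) (2 ^+ n / 2 `^ p)).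
- exact: measurable_outer_weight.
- exact: outer_weight_ge0.
- by move=> k; rewrite invr_ge0 exprn_ge0// ltW.
- by move=> k; rewrite exprn_ge0.
- by rewrite divr_gt0// exprn_gt0.
- rewrite ltr_pdivrMr// mul1r -powR_mulrn//.
  by rewrite /powR pnatr_eq0/= ltr_expR ltr_pM2r// ln_gt0// ltr1n.
- move=> k; rewrite exprS mulrA (_ : 2 * 2 = 4 :> R); last by lra.
  rewrite !exprMn !exprVn -!exprM mulnC mulrC.
  by rewrite -mulrA lexx.
- move=> x; rewrite /outer_weight indicE.
  have [x1|] := boolP (x \in ~` cube 1); last first.
    by rewrite mul0r eqxx.
  move=> _; rewrite mul1r.
  have {}x1 : 1 <= `|x|.
    by move: x1; rewrite inE /cube/= => /negP; rewrite -ltNge => /ltW.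
  have [k /andP[kx xk]] := dyadic_floor x1; exists k => //.
  rewrite -powR_exprn// lef_pV2 ?posrE ?powR_gt0 ?exprn_gt0//; last first.
    by rewrite (lt_le_trans ltr01).
  by apply: ler_powRl; rewrite ?exprn_ge0// ltW.
Qed.

Lemma integrable_inner_weight (p : R) : 0 <= p -> p < n%:R + 2 ->
  (lebesgue_rV n).-integrable setT (EFin \o inner_weight p).
Proof.
move=> p0 pn.
have P0 : 0 < 2 `^ p by rewrite powR_gt0.
(* On the shell 2^(-k-1) <= |x| <= 2^(-k) one has |x|^2 <= 4^(-k) and |x|^(-p) <= 2^(p(k+1)), and
   the enclosing cube has measure (2 * 2^(-k))^n. The ratio 2^(p-2-n) is below 1 because p < n +
   2. *)
apply: (@integrable_dyadic _ _ _ (fun k => 2 `^ p * (2 `^ p / 4) ^+ k)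
  (fun k => 2 ^- k) (2 `^ p * 2 ^+ n) (2 `^ p / 4 / 2 ^+ n)).
- exact: measurable_inner_weight.
- exact: inner_weight_ge0.
- by move=> k; rewrite mulr_ge0 ?exprn_ge0 ?divr_ge0// ltW.
- by move=> k; rewrite invr_ge0 exprn_ge0.
- by rewrite !divr_gt0// exprn_gt0.
- rewrite ltr_pdivrMr ?exprn_gt0// mul1r ltr_pdivrMr//.
  rewrite (_ : 4 = 2 ^+ 2 :> R); last by rewrite expr2; lra.
  rewrite -exprD -powR_mulrn// natrD.
  by rewrite /powR pnatr_eq0/= ltr_expR ltr_pM2r// ln_gt0// ltr1n.
- move=> k; rewrite !exprMn !exprVn -!exprM (mulnC k n).
  set A := 2 `^ p; set B := A ^+ k; set D := 2 ^+ n; set E := _^-1; set F := _^-1.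
  by rewrite (_ : A * D * (B * E * F) = A * (B * E) * (D * F))//; ring.
- move=> x; rewrite /inner_weight indicE.
  have [x1|] := boolP (x \in cube 1); last first.
    by rewrite mul0r eqxx.
  rewrite mul1r.
  have {}x1 : `|x| <= 1 by move: x1; rewrite inE.
  have [->|x0] := eqVneq `|x| 0; first by rewrite expr0n mul0r eqxx.
  move=> _; have {}x0 : 0 < `|x| by rewrite lt_def x0/=.
  (* The shell of a small [x] is found by applying [dyadic_floor] to 1/|x|. *)
  have : 1 <= `|x|^-1 by rewrite invf_ge1.
  move=> /dyadic_floor [k /andP[kx xk]]; exists k.
    by rewrite -[leLHS]invrK lef_pV2 ?posrE ?invr_gt0 ?exprn_gt0.
  (* Splits the constant into the bound for |x|^2 and the bound for |x|^(-p), compared factor by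
     factor. *)
  have -> : 2 `^ p * (2 `^ p / 4) ^+ k = (2 ^- k) ^+ 2 * (2 `^ p) ^+ k.+1.
    have -> : 4 = 2 ^+ 2 :> R by rewrite expr2; lra.
    by rewrite exprMn (exprS _ k) -!exprVn -!exprM (mulnC k); ring.
  apply: ler_pM.
  + by rewrite exprn_ge0.
  + by rewrite invr_ge0 powR_ge0.
  + rewrite lerXn2r// ?nnegrE ?invr_ge0 ?exprn_ge0//.
    by rewrite -[leLHS]invrK lef_pV2 ?posrE ?invr_gt0 ?exprn_gt0.
  + rewrite -powR_exprn// invr_powR//.
    by apply: ler_powRl; rewrite ?invr_ge0.
Qed.

End weights.

(** * Mean value estimates and Schwartz functions *)

Section mean_value.
Context {R : realType} {n : nat}.
Implicit Types (f g : 'rV[R]_n -> R) (x y : 'rV[R]_n) (i : 'I_n).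

(** Restricting to a line turns directional derivatives into one-variable ones, so that the mean
    value theorem on a segment becomes available. *)
Lemma is_derive_line f x v (t : R) : derivable f (x + t *: v) v ->
  is_derive t 1 (fun s : R => f (x + s *: v)) ('D_v f (x + t *: v)).
Proof.
move=> df.
have E : (fun h : R => h^-1 *: (f (x + (h *: (1 : R) + t) *: v) - f (x + t *: v)))
    = (fun h : R => h^-1 *: (f (h *: v + (x + t *: v)) - f (x + t *: v))).
  apply/funext => h; congr (_ *: (f _ - _)).
  by rewrite [h *: 1]mulr1 scalerDl addrCA.
apply: DeriveDef.
  by rewrite /derivable/= E; exact: df.
by rewrite /derive/= E.
Qed.

Lemma derivable_shift f x y v : derivable f (x + y) v ->
  derivable (fun z => f (z + y)) x v /\
  'D_v (fun z => f (z + y)) x = 'D_v f (x + y).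
Proof.
move=> df.
have E : (fun h : R => h^-1 *: (f (h *: v + x + y) - f (x + y)))
    = (fun h : R => h^-1 *: (f (h *: v + (x + y)) - f (x + y))).
  by apply/funext => h; rewrite addrA.
by split; rewrite /derivable /derive/= E.
Qed.

Lemma line_lipschitz f v (M : R) : (forall x, derivable f x v) ->
  (forall x, `|'D_v f x| <= M) ->
  forall x (t : R), `|f (x + t *: v) - f x| <= M * `|t|.
Proof.
move=> df dM x t.
have der (s : R) := is_derive_line (df (x + s *: v)).
have cont (a b : R) : {within `[a, b], continuous (fun s : R => f (x + s *: v))}.
  by apply: derivable_within_continuous => s _; have [] := der s.
have x0 : f x = f (x + 0 *: v) by rewrite scale0r addr0.
(* The mean value theorem wants ordered endpoints, hence the segment from 0 to t or from t to 0. *)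
have [t0|t0] := leP 0 t.
  have [c _] := MVT_segment t0 (fun s _ => der s) (cont 0 t).
  by rewrite -x0 subr0 => ->; rewrite normrM ler_wpM2r.
have [c _] := MVT_segment (ltW t0) (fun s _ => der s) (cont t 0).
rewrite -x0 sub0r => fE; rewrite distrC fE normrM normrN.
by rewrite ler_wpM2r.
Qed.

(** The path from [x] to [x + y] moves along one coordinate at a time. Each of the n moves costs at
    most M |y|, since every coordinate is bounded by the sup norm. *)
Lemma partial_lipschitz f (M : R) :
  (forall i x, derivable f x (basisv i)) ->
  (forall i x, `|'D_(basisv i) f x| <= M) ->
  forall x y, `|f (x + y) - f x| <= M * n%:R * `|y|.
Proof.
move=> df dM x y.
rewrite [y in f (x + y)]row_sum_delta.
have -> : M * n%:R * `|y| = \sum_(i < n) M * `|y|.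
  by rewrite sumr_const card_ord -[RHS]mulr_natr mulrAC.
(* The base point [x] stays general because each coordinate move displaces it. *)
elim: (index_enum _) x => [|i s IHs] x.
  by rewrite !big_nil addr0 subrr normr0.
rewrite !big_cons addrA.
rewrite (_ : _ - f x =
  (f (x + y ord0 i *: basisv i + \sum_(j <- s) y ord0 j *: delta_mx 0 j)
  - f (x + y ord0 i *: basisv i)) + (f (x + y ord0 i *: basisv i) - f x)); last first.
  by rewrite addrA subrK.
rewrite [leRHS]addrC (le_trans (ler_normD _ _))// lerD ?IHs//.
rewrite (le_trans (line_lipschitz (df i) (dM i) _ _))//.
rewrite ler_wpM2l ?rV_coord_le//.
by rewrite (le_trans _ (dM i 0)).
Qed.

(* The second difference is an increment of z |-> g z - g (z - y), whose partial
   derivatives are O(|y|) because those of g are Lipschitz. *)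
Lemma second_difference_bound g (M : R) :
  (forall i x, derivable g x (basisv i)) ->
  (forall i j x, derivable ('D_(basisv i) g) x (basisv j)) ->
  (forall i j x, `|'D_(basisv j) ('D_(basisv i) g) x| <= M) ->
  forall x y, `|2 * g x - g (x + y) - g (x - y)| <= M * n%:R ^+ 2 * `|y| ^+ 2.
Proof.
move=> dg ddg ddM x y.
pose h z := g z - g (z - y).
have dh i z : derivable h z (basisv i) /\
    'D_(basisv i) h z = 'D_(basisv i) g z - 'D_(basisv i) g (z - y).
  have [d1 d2] := derivable_shift (dg i (z - y)).
  split; first exact: derivableB.
  by rewrite deriveB// d2.
have -> : 2 * g x - g (x + y) - g (x - y) = - (h (x + y) - h x).
  by rewrite /h addrK; ring.
rewrite normrN (_ : M * _ * _ = (M * n%:R * `|y|) * n%:R * `|y|); last by ring.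
apply: partial_lipschitz => i z; first by case: (dh i z).
have [_ ->] := dh i z.
have := partial_lipschitz (ddg i) (ddM i) (z - y) y.
by rewrite subrK.
Qed.

End mean_value.

(** * Real Schwartz functions: decay and integrability *)

Section rschwartz.
Context {R : realType} {n : nat}.
Implicit Types (f g : 'rV[R]_n -> R) (x y : 'rV[R]_n) (i : 'I_n).

Definition rpartials (w : seq 'I_n) f : 'rV[R]_n -> R :=
  foldr (fun i g => 'D_(basisv i) g) f w.

(** Real-valued counterpart of [schwartz], satisfied by the real and imaginary parts; the
    real-analysis estimates are all made for this class. *)
Definition rschwartz f := forall w, [/\ continuous (rpartials w f),
  forall i x, derivable (rpartials w f) x (basisv i) &
  forall a, exists M : R, forall x, `|monomial a x * rpartials w f x| <= M].

Lemma Re_cpartials w (u : 'rV[R]_n -> R[i]) :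
  @complex.Re R \o cpartials w u = rpartials w (@complex.Re R \o u).
Proof. by elim: w => //= i w <-. Qed.

Lemma Im_cpartials w (u : 'rV[R]_n -> R[i]) :
  @complex.Im R \o cpartials w u = rpartials w (@complex.Im R \o u).
Proof. by elim: w => //= i w <-. Qed.

Lemma normc_ge_Im (z : R[i]) : `|complex.Im z|%:C%C <= `|z|.
Proof.
by case: z => a b; rewrite normc_def lecR/= -sqrtr_sqr ler_wsqrtr// lerDr sqr_ge0.
Qed.

Lemma schwartz_Re (u : 'rV[R]_n -> R[i]) :
  schwartz u -> rschwartz (@complex.Re R \o u).
Proof.
move=> [su bu] w; have [[cu _] du] := su w.
rewrite -Re_cpartials; split=> // [i x|a]; first by have [] := du i x.
have [M uM] := bu a w; exists M => x; have := uM x.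
move=> /(le_trans (normc_ge_Re _)); rewrite lecR.
by rewrite /=; case: (cpartials w u x) => b c /=; rewrite mul0r subr0.
Qed.

Lemma schwartz_Im (u : 'rV[R]_n -> R[i]) :
  schwartz u -> rschwartz (@complex.Im R \o u).
Proof.
move=> [su bu] w; have [[_ cu] du] := su w.
rewrite -Im_cpartials; split=> // [i x|a]; first by have [] := du i x.
have [M uM] := bu a w; exists M => x; have := uM x.
move=> /(le_trans (normc_ge_Im _)); rewrite lecR.
by rewrite /=; case: (cpartials w u x) => b c /=; rewrite mul0r addr0.
Qed.

Lemma rschwartz_partial i f : rschwartz f -> rschwartz ('D_(basisv i) f).
Proof.
(* The last letter of a word acts first under [foldr], so appending [i] differentiates [f] before
   [w] does. *)
move=> sf w; have := sf (rcons w i).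
by rewrite /rpartials foldr_rcons.
Qed.

Lemma rschwartz_continuous f : rschwartz f -> continuous f.
Proof. by move=> /(_ [::]) []. Qed.

Lemma rschwartz_derivable f : rschwartz f ->
  forall i x, derivable f x (basisv i).
Proof. by move=> /(_ [::]) []. Qed.

Lemma rschwartz_measurable f : rschwartz f -> measurable_fun setT f.
Proof. by move=> /rschwartz_continuous; exact: continuous_measurable_rV. Qed.

Lemma rschwartz_bounded f : rschwartz f -> exists M : R, forall x, `|f x| <= M.
Proof.
move=> /(_ [::]) [_ _ /(_ (fun=> 0%N)) [M fM]]; exists M => x.
by have := fM x; rewrite /monomial big1 ?mul1r// => i _.
Qed.

Lemma monomial1 i m x :
  monomial (fun j => if j == i then m else 0%N) x = x ord0 i ^+ m.
Proof.
rewrite /monomial (bigD1 i)//= eqxx big1 ?mulr1// => j /negbTE ->.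
by rewrite expr0.
Qed.

(** The sup norm of [x] is the modulus of one of its coordinates, so its power is a pure monomial in
    that coordinate. Summing the monomial bounds over all coordinates gives a constant independent
    of which one it is. *)
Lemma rschwartz_decay f m : rschwartz f ->
  exists M : R, forall x, `|x| ^+ m.+1 * `|f x| <= M.
Proof.
move=> /(_ [::]) [_ _ fM].
have [M_ M_P] := choice (fun i => fM (fun j => if j == i then m.+1 else 0%N)).
have M0 i : 0 <= M_ i by rewrite (le_trans _ (M_P i 0)).
exists (\sum_i M_ i) => x.
(* The exponent [m.+1] is positive, which makes the left side vanish at the origin. *)
have [->|x0] := eqVneq `|x| 0; first by rewrite expr0n mul0r sumr_ge0.
have [[j i]/= xi] := mx_norm_neq0 x0.
rewrite [`|x|]xi ord1 -normrX -normrM (bigD1 i)//=.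
have := M_P i x; rewrite monomial1 => /le_trans; apply.
by rewrite lerDl sumr_ge0.
Qed.

Lemma integrable_outer_inner (M N p q : R) :
  n%:R < p -> 0 <= q -> q < n%:R + 2 ->
  (lebesgue_rV n).-integrable setT
    (EFin \o (fun x => M * inner_weight q x + N * outer_weight p x)).
Proof.
move=> np q0 qn.
rewrite (_ : _ \o _ = (fun x => M%:E * (inner_weight q x)%:E) \+
   (fun x => N%:E * (outer_weight p x)%:E))%E//.
by apply: integrableD => //; apply: integrableZl => //;
  [exact: (integrable_inner_weight q0 qn)|exact: (integrable_outer_weight np)].
Qed.

Lemma le_integrableR (f g : 'rV[R]_n -> R) : measurable_fun setT f ->
  (forall x, `|f x| <= g x) -> (lebesgue_rV n).-integrable setT (EFin \o g) ->
  (lebesgue_rV n).-integrable setT (EFin \o f).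
Proof.
move=> mf fg; apply: le_integrable => //; first exact/measurable_EFinP.
by move=> x _; rewrite /= lee_fin (le_trans (fg x))// ler_norm.
Qed.

Lemma integrable_cube1 : (lebesgue_rV n).-integrable setT
  (EFin \o (fun x => \1_(cube 1) x : R)).
Proof.
have m1 := @measurable_cube R n 1 ler01.
apply/integrableP; split; first by apply/measurable_EFinP; exact: measurable_indic.
rewrite (eq_integral (fun x => (\1_(cube 1) x)%:E)); last first.
  by move=> x _; rewrite /= ger0_norm.
rewrite integral_indic// setIT.
by have /= -> := @lebesgue_rV_cube R n 1 ler01; rewrite ltry.
Qed.

(** [f] is bounded on the unit cube and O(|x|^(-n-1)) outside it, with exponent n + 1 > n as
    [outer_weight] requires. *)
Lemma rschwartz_integrable f : rschwartz f ->
  (lebesgue_rV n).-integrable setT (EFin \o f).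
Proof.
move=> sf; have [M fM] := rschwartz_bounded sf.
have [N fN] := rschwartz_decay n sf.
apply: (@le_integrableR _
  (fun x => M * \1_(cube 1) x + N * outer_weight n.+1%:R x)).
- exact: rschwartz_measurable.
- move=> x; rewrite /outer_weight !indicE in_setC.
  have [x1|x1] := boolP (x \in cube 1).
    by rewrite mulr1 mul0r mulr0 addr0.
  have {}x1 : 0 < `|x|.
    move: x1; rewrite notin_setE /cube/= => /negP; rewrite -ltNge.
    exact: lt_trans.
  rewrite mulr0 add0r mul1r powR_mulrn// ler_pdivlMr ?exprn_gt0//.
  by rewrite mulrC.
- rewrite (_ : _ \o _ = (fun x => M%:E * (\1_(cube 1) x)%:E) \+
     (fun x => N%:E * (outer_weight n.+1%:R x)%:E))%E//.
  apply: integrableD => //; apply: integrableZl => //; first exact: integrable_cube1.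
  by apply: integrable_outer_weight; rewrite ltr_nat.
Qed.

End rschwartz.

(** * The Laplacian *)

Section integration_by_parts.
Context {R : realType} {n : nat}.
Implicit Types (f g : 'rV[R]_n -> R) (x y : 'rV[R]_n) (i : 'I_n).
Local Notation mu := (@lebesgue_rV R n).

Lemma measurable_shift f y : measurable_fun setT f ->
  measurable_fun setT (fun x => f (x + y)).
Proof. by move=> mf; exact: (measurableT_comp mf (measurable_rV_shift y)). Qed.

Lemma integrableBR f g : mu.-integrable setT (EFin \o f) ->
  mu.-integrable setT (EFin \o g) ->
  mu.-integrable setT (EFin \o (fun x => f x - g x)).
Proof. by move=> fi gi; exact: (integrableB measurableT fi gi). Qed.

Lemma integrableZR f (a : R) : mu.-integrable setT (EFin \o f) ->
  mu.-integrable setT (EFin \o (fun x => a * f x)).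
Proof. by move=> fi; exact: (integrableZl measurableT a fi). Qed.

Lemma integrable_mul_bounded f g (M : R) :
  mu.-integrable setT (EFin \o f) -> measurable_fun setT g ->
  (forall x, `|g x| <= M) -> mu.-integrable setT (EFin \o (fun x => f x * g x)).
Proof.
move=> fi mg gM; have mf : measurable_fun setT f.
  by apply/measurable_EFinP; exact: measurable_int fi.
apply: (@le_integrableR _ _ _ (fun x => `|f x| * M)).
- exact: measurable_funM.
- by move=> x; rewrite normrM ler_wpM2l.
- rewrite (_ : _ \o _ = (fun x => `|(EFin \o f) x| * M%:E)%E)//.
  by apply: integrableZr => //; exact: integrable_abse.
Qed.

Lemma Rintegral_shift_mul f g y :
  measurable_fun setT f -> measurable_fun setT g ->
  (\int[mu]_x (f x * g (x + y)) = \int[mu]_x (f (x - y) * g x))%R.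
Proof.
move=> mf mg; congr fine.
rewrite -[RHS](@integral_rV_shift _ _ y).
  by apply: eq_integral => x _; rewrite addrK.
by apply/measurable_EFinP; apply: measurable_funM => //; exact: measurable_shift.
Qed.

Lemma difference_quotient_cvg f x v (u : nat -> R) : derivable f x v ->
  (forall m, u m != 0) -> u @ \oo --> 0 ->
  ((u m)^-1 * (f (x + u m *: v) - f x)) @[m --> \oo] --> 'D_v f x.
Proof.
move=> df u0 cu.
(* The derivative is a limit over punctured neighbourhoods, which the nonzero sequence [u]
   respects. *)
have du : u @ \oo --> 0^'.
  move=> A; rewrite /dnbhs /within/= => /cu uA.
  have : \forall m \near \oo, u m != 0 -> A (u m) by exact: uA.
  by apply: filterS => m; apply; exact: u0.
rewrite (_ : (fun m => _) =
  (fun h : R => h^-1 *: (f (h *: v + x) - f x)) \o u); last first.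
  by apply/funext => m /=; rewrite [_ *: v + x]addrC.
exact: (cvg_comp _ _ du df).
Qed.

(** Dominated convergence: by [line_lipschitz] the difference quotients of [g] are bounded by [M],
    so [|f| * M] dominates for every step size. *)
Lemma Rintegral_difference_quotient_cvg f g v (M : R) (u : nat -> R) :
  mu.-integrable setT (EFin \o f) ->
  measurable_fun setT g -> measurable_fun setT ('D_v g) ->
  (forall x, derivable g x v) -> (forall x, `|'D_v g x| <= M) ->
  (forall m, u m != 0) -> u @ \oo --> 0 ->
  (\int[mu]_x (f x * ((u m)^-1 * (g (x + u m *: v) - g x))))%R
    @[m --> \oo] --> (\int[mu]_x (f x * 'D_v g x))%R.
Proof.
move=> fi mg mDg dg dgM u0 cu.
have mf : measurable_fun setT f.
  by apply/measurable_EFinP; exact: measurable_int fi.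
pose F m x := (f x * ((u m)^-1 * (g (x + u m *: v) - g x)))%:E.
have [|||||fDi _ cF] := @dominated_convergence _ _ _ mu setT measurableT F
  (fun x => (f x * 'D_v g x)%:E) (fun x => (`|f x| * M)%:E).
- move=> m; apply/measurable_EFinP; apply: measurable_funM => //.
  apply: measurable_funM => //; apply: measurable_funB => //.
  exact: measurable_shift.
- by apply/measurable_EFinP; exact: measurable_funM.
- apply: aeW => x _; apply: cvg_EFin; first exact: nearW.
  by apply: cvgM; [exact: cvg_cst|exact: difference_quotient_cvg].
- rewrite (_ : (fun x => _) = (fun x => `|(EFin \o f) x| * M%:E)%E)//.
  by apply: integrableZr => //; exact: integrable_abse.
- apply: aeW => x m _; rewrite lee_fin normrM ler_wpM2l// normrM normfV.
  rewrite ler_pdivrMl ?normr_gt0// mulrC.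
  exact: line_lipschitz.
rewrite /Rintegral; apply: fine_cvg.
rewrite fineK//; exact: integrable_fin_num.
Qed.

(** Difference quotients of [g] with step h, paired with [f], equal minus those of [f] with step -h,
    paired with [g]. Letting h = 1/(m+1) tend to 0 on both sides gives the identity. *)
Lemma Rintegral_by_parts i f g : rschwartz f -> rschwartz g ->
  (\int[mu]_x (f x * 'D_(basisv i) g x) = - \int[mu]_x ('D_(basisv i) f x * g x))%R.
Proof.
move=> sf sg; set e := basisv i.
have [Mf fM] := rschwartz_bounded sf; have [Mg gM] := rschwartz_bounded sg.
have [Nf dfM] := rschwartz_bounded (rschwartz_partial i sf).
have [Ng dgM] := rschwartz_bounded (rschwartz_partial i sg).
have fi := rschwartz_integrable sf; have gi := rschwartz_integrable sg.
have mf := rschwartz_measurable sf; have mg := rschwartz_measurable sg.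
have mdf := rschwartz_measurable (rschwartz_partial i sf).
have mdg := rschwartz_measurable (rschwartz_partial i sg).
have h0 m : @harmonic R m != 0 by rewrite /harmonic/= invr_eq0 pnatr_eq0.
have Nh0 m : - @harmonic R m != 0 by rewrite oppr_eq0.
have Nch : (fun m => - @harmonic R m) @ \oo --> (0 : R).
  by rewrite -oppr0; apply: cvgN; exact: cvg_harmonic.
have c1 := Rintegral_difference_quotient_cvg fi mg mdg (@rschwartz_derivable _ _ _ sg i)
  dgM h0 (@cvg_harmonic R).
have := Rintegral_difference_quotient_cvg gi mf mdf (@rschwartz_derivable _ _ _ sf i)
  dfM Nh0 Nch.
move=> /cvgN c2.
rewrite [X in _ = - X](_ : _ = (\int[mu]_x (g x * 'D_e f x))%R); last first.
  by apply: eq_Rintegral => x _; rewrite mulrC.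
rewrite -(cvg_lim (@norm_hausdorff _ _) c1) -(cvg_lim (@norm_hausdorff _ _) c2).
congr (lim (_ @ \oo)); apply/funext => m /=; set h := m.+1%:R^-1; apply/esym.
have fgi (y : 'rV[R]_n) : mu.-integrable setT (EFin \o (fun x => f x * g (x + y))).
  by apply: (@integrable_mul_bounded _ _ Mg) => //; exact: measurable_shift.
have gfi (y : 'rV[R]_n) : mu.-integrable setT (EFin \o (fun x => f (x + y) * g x)).
  apply: (@integrable_mul_bounded _ _ Mg) => //.
  exact: (integrable_rV_shift y fi).
have gfi0 : mu.-integrable setT (EFin \o (fun x => f x * g x)).
  exact: (@integrable_mul_bounded _ _ Mg).
(* Common middle form: the left side reaches it by linearity, the right side by moving the
   translation from [g] to [f]. *)
transitivity (h^-1 * (\int[mu]_x (f (x - h *: e) * g x) - \int[mu]_x (f x * g x)))%R.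
  rewrite -RintegralB// -RintegralZl//; last exact: integrableBR.
  rewrite -[LHS]mulN1r -RintegralZl//; last first.
    rewrite (_ : (fun x => _) =
        (fun x => (- h)^-1 * (f (x + - h *: e) * g x - f x * g x))); last first.
      by apply/funext => x; ring.
    by apply: integrableZR; exact: integrableBR.
  by apply: eq_Rintegral => x _; rewrite invrN scaleNr; ring.
rewrite -Rintegral_shift_mul// -RintegralB// -RintegralZl//; last exact: integrableBR.
by apply: eq_Rintegral => x _; ring.
Qed.

End integration_by_parts.

Section laplacian.
Context {R : realType} {n : nat}.
Implicit Types (f g : 'rV[R]_n -> R) (x y : 'rV[R]_n).
Local Notation mu := (@lebesgue_rV R n).

Lemma Rintegral_sum (I : Type) (s : seq I) (F : I -> 'rV[R]_n -> R) :
  (forall i, mu.-integrable setT (EFin \o F i)) ->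
  mu.-integrable setT (EFin \o (fun x => \sum_(i <- s) F i x)) /\
  (\int[mu]_x (\sum_(i <- s) F i x) = \sum_(i <- s) \int[mu]_x F i x)%R.
Proof.
move=> Fi; elim: s => [|i s [IHi IHs]].
  under eq_fun do rewrite big_nil.
  rewrite !big_nil; split; last by rewrite Rintegral_cst// mul0r.
  exact: integrable0.
under eq_fun do rewrite big_cons.
rewrite big_cons; split; first exact: (integrableD measurableT (Fi i) IHi).
by rewrite RintegralD// IHs.
Qed.

Lemma integrable_mul_rschwartz f g : rschwartz f -> rschwartz g ->
  mu.-integrable setT (EFin \o (fun x => f x * g x)).
Proof.
move=> sf sg; have [M gM] := rschwartz_bounded sg.
apply: (integrable_mul_bounded _ _ gM); first exact: rschwartz_integrable.
exact: rschwartz_measurable.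
Qed.

Lemma Rintegral_mul_sum f (G : 'I_n -> 'rV[R]_n -> R) :
  (forall k, mu.-integrable setT (EFin \o (fun x => f x * G k x))) ->
  mu.-integrable setT (EFin \o (fun x => f x * \sum_k G k x)) /\
  (\int[mu]_x (f x * \sum_k G k x) = \sum_k \int[mu]_x (f x * G k x))%R.
Proof.
move=> fG; have -> : (fun x => f x * \sum_k G k x) = (fun x => \sum_k f x * G k x).
  by apply/funext => x; rewrite mulr_sumr.
exact: (Rintegral_sum (index_enum 'I_n) fG).
Qed.

(** One integration by parts on each side leads to minus the integral of the product of the first
    derivatives, which is symmetric in [f] and [g]. *)
Lemma Rintegral_by_parts2 k f g : rschwartz f -> rschwartz g ->
  (\int[mu]_x (f x * 'D_(basisv k) ('D_(basisv k) g) x) =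
   \int[mu]_x (g x * 'D_(basisv k) ('D_(basisv k) f) x))%R.
Proof.
move=> sf sg.
have fk := rschwartz_partial k sf; have gk := rschwartz_partial k sg.
have e1 := Rintegral_by_parts k sf gk; have e2 := Rintegral_by_parts k sg fk.
have e3 : (\int[mu]_x ('D_(basisv k) f x * 'D_(basisv k) g x) =
    \int[mu]_x ('D_(basisv k) g x * 'D_(basisv k) f x))%R.
  by apply: eq_Rintegral => x _; rewrite mulrC.
exact: (etrans (etrans e1 (congr1 -%R e3)) (esym e2)).
Qed.

Definition rlaplace f x : R := \sum_(k < n) 'D_(basisv k) ('D_(basisv k) f) x.

Lemma rlaplace_symmetric f g : rschwartz f -> rschwartz g ->
  mu.-integrable setT (EFin \o (fun x => f x * rlaplace g x)) /\
  (\int[mu]_x (f x * rlaplace g x) = \int[mu]_x (g x * rlaplace f x))%R.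
Proof.
move=> sf sg; have D2 a b k : rschwartz a -> rschwartz b ->
    mu.-integrable setT (EFin \o (fun x => a x * 'D_(basisv k) ('D_(basisv k) b) x)).
  move=> sa sb; apply: (integrable_mul_rschwartz sa).
  exact: (rschwartz_partial _ (rschwartz_partial _ sb)).
have [i1 e1] := Rintegral_mul_sum (fun k => D2 f g k sf sg).
have [_ e2] := Rintegral_mul_sum (fun k => D2 g f k sg sf).
split; first exact: i1.
have e3 := @eq_bigr R 0 +%R _ (index_enum 'I_n) xpredT _ _
  (fun k _ => Rintegral_by_parts2 k sf sg).
exact: (etrans e1 (etrans e3 (esym e2))).
Qed.

End laplacian.

(** * The fractional Laplacian *)

Section fractional.
Context {R : realType} {n : nat}.
Implicit Types (f g : 'rV[R]_n -> R) (x y : 'rV[R]_n).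
Local Notation mu := (@lebesgue_rV R n).
Variable s : R.
Hypotheses (s_gt0 : 0 < s) (s_lt1 : s < 1).

Let p : R := n%:R + 2 * s.

Let p_gt0 : 0 < p.
Proof. by rewrite /p ltr_wpDl// mulr_gt0. Qed.

Lemma norm_le_enorm x : `|x| <= enorm x.
Proof.
apply/rV_norm_leP => [|i]; first exact: sqrtr_ge0.
rewrite -sqrtr_sqr; apply: ler_wsqrtr.
by rewrite (bigD1 i)//= lerDl sumr_ge0// => j _; exact: sqr_ge0.
Qed.

Lemma enorm0 : enorm (0 : 'rV[R]_n) = 0.
Proof. by rewrite /enorm big1 ?sqrtr0// => i _; rewrite mxE expr0n. Qed.

Lemma measurable_enorm : measurable_fun setT (@enorm R n).
Proof.
apply: (measurableT_comp (continuous_measurable_fun (@sqrt_continuous R))).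
apply: measurable_sum => i; apply: measurable_funX; exact: measurable_coord.
Qed.

(** The kernel uses the Euclidean norm and the weights the sup norm; the latter is smaller, so its
    negative power is larger. At the origin both sides coincide. *)
Lemma kernel_le y : (enorm y `^ p)^-1 <= (`|y| `^ p)^-1.
Proof.
have [->|y0] := eqVneq y 0; first by rewrite enorm0 normr0.
have {}y0 : 0 < `|y| by rewrite normr_gt0.
rewrite lef_pV2 ?posrE ?powR_gt0//; last exact: lt_le_trans (norm_le_enorm y).
by apply: ler_powRl (norm_le_enorm y) => //; exact: ltW.
Qed.

Definition second_difference f x y : R := 2 * f x - f (x + y) - f (x - y).

(** The majorant [w] depends on y alone; this uniformity in x later gives the product bound |f(x)|
    w(y) needed for Fubini. *)
Lemma kernel_bound g : rschwartz g -> exists w : 'rV[R]_n -> R,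
  mu.-integrable setT (EFin \o w) /\
  forall x y, `|second_difference g x y / enorm y `^ p| <= w y.
Proof.
move=> sg.
have [M gM] := rschwartz_bounded sg.
have bnd ij : exists N : R, forall x, `|'D_(basisv ij.2) ('D_(basisv ij.1) g) x| <= N.
  by apply: rschwartz_bounded; do 2 apply: rschwartz_partial.
have [N_ N_P] := choice bnd.
(* Summing the bounds yields one constant for all second partial derivatives. *)
pose N := \sum_ij N_ ij.
have N0 ij : 0 <= N_ ij by rewrite (le_trans _ (N_P ij 0)).
have gN i j x : `|'D_(basisv j) ('D_(basisv i) g) x| <= N.
  rewrite (le_trans (N_P (i, j) x))// /N (bigD1 (i, j))//= lerDl.
  by rewrite sumr_ge0.
(* Near the origin the constant is that of [second_difference_bound]; far away, 4 M bounds 2 g(x) -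
   g(x+y) - g(x-y). Integrability uses n < n + 2s < n + 2, that is 0 < s < 1. *)
exists (fun y => N * n%:R ^+ 2 * inner_weight p y + 4 * M * outer_weight p y); split.
  apply: integrable_outer_inner; rewrite /p.
  - by rewrite ltrDl mulr_gt0.
  - exact: ltW.
  - by rewrite ltrD2l gtr_pMr.
move=> x y; rewrite normrM [X in _ * X]ger0_norm ?invr_ge0 ?powR_ge0//.
apply: (le_trans (ler_wpM2l _ (kernel_le y))) => //.
rewrite /inner_weight /outer_weight !indicE in_setC.
have [y1|y1] := boolP (y \in cube 1).
  rewrite mul1r mul0r mulr0 addr0 mulrA ler_wpM2r ?invr_ge0 ?powR_ge0//.
  apply: second_difference_bound => //.
  + by move=> i z; exact: rschwartz_derivable.
  + by move=> i j z; apply: rschwartz_derivable; exact: rschwartz_partial.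
rewrite mul0r mulr0 add0r mul1r ler_wpM2r ?invr_ge0 ?powR_ge0//.
have := gM x; have := gM (x + y); have := gM (x - y).
rewrite /second_difference !ler_norml.
by move=> /andP[a b] /andP[c d] /andP[e h]; apply/andP; split; lra.
Qed.

End fractional.

(** * Exchange of integrals and symmetry for 0 < s < 1 *)

Section fractional_fubini.
Context {R : realType} {n : nat}.
Implicit Types (f g : 'rV[R]_n -> R) (x y : 'rV[R]_n).
Local Notation mu := (@lebesgue_rV R n).
Variable s : R.
Hypotheses (s_gt0 : 0 < s) (s_lt1 : s < 1).

Let K y : R := (enorm y `^ (n%:R + 2 * s))^-1.

Lemma measurable_kernel : measurable_fun setT K.
Proof.
rewrite /K; under eq_fun do rewrite -powRN.
exact: (measurableT_comp (measurable_powR _) measurable_enorm).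
Qed.

Definition rfrac g x : R :=
  \int[mu]_y (second_difference g x y / enorm y `^ (n%:R + 2 * s)).

Let Phi f g (z : 'rV[R]_n * 'rV[R]_n) : R :=
  f z.1 * (second_difference g z.1 z.2 * K z.2).

Let measurable_second_difference g : measurable_fun setT g ->
  measurable_fun setT (fun z : 'rV[R]_n * 'rV[R]_n => second_difference g z.1 z.2).
Proof.
move=> mg; apply: measurable_funB; last first.
  by have := measurableT_comp mg (@measurable_rV_sub R n).
apply: measurable_funB; last first.
  by have := measurableT_comp mg (@measurable_rV_add R n).
apply: measurable_funM; first exact: measurable_cst.
exact: (measurableT_comp mg measurable_fst).
Qed.

Let measurable_Phi f g : rschwartz f -> rschwartz g ->
  measurable_fun setT (EFin \o Phi f g).
Proof.
move=> /rschwartz_measurable mf /rschwartz_measurable mg.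
apply/measurable_EFinP; apply: measurable_funM.
  exact: (measurableT_comp mf measurable_fst).
apply: measurable_funM; first exact: measurable_second_difference.
exact: (measurableT_comp measurable_kernel measurable_snd).
Qed.

Lemma integrable_second_difference g x : rschwartz g ->
  mu.-integrable setT (EFin \o (fun y => second_difference g x y * K y)).
Proof.
move=> sg; have [w [wi gw]] := kernel_bound s_gt0 s_lt1 sg.
apply: (le_integrableR _ (gw x) wi).
apply: measurable_funM; last exact: measurable_kernel.
exact: measurable_fun_pair2 (measurable_second_difference (rschwartz_measurable sg)).
Qed.

(** By Tonelli it suffices to bound the iterated integral of |Phi|, which is at most the integral of
    |f| times the integral of the majorant [w]. *)
Let integrable_Phi f g : rschwartz f -> rschwartz g ->
  (mu \x mu)%E.-integrable setT (EFin \o Phi f g).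
Proof.
move=> sf sg; have [w [wi gw]] := kernel_bound s_gt0 s_lt1 sg.
have mP := measurable_Phi sf sg.
apply/(integrable12ltyP _ _ mP).
have w0 y : 0 <= w y by rewrite (le_trans _ (gw 0 y)).
apply: (@le_lt_trans _ _ (\int[mu]_x (`|f x|%:E * \int[mu]_y (w y)%:E))%E).
  have mw : measurable_fun setT (EFin \o w) by exact: measurable_int wi.
  apply: ge0_le_integral => //.
  - by move=> x _; exact: integral_ge0.
  - apply: (measurable_fun_fubini_tonelli_F (fun z => `|(EFin \o Phi f g) z|%E)) => //.
    exact: measurableT_comp.
  - apply: emeasurable_funM => //; apply/measurable_EFinP.
    by apply: measurableT_comp => //; exact: rschwartz_measurable.
  - move=> x _; rewrite -ge0_integralZl_EFin//; last by move=> y _; rewrite lee_fin.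
    apply: ge0_le_integral => //.
    + apply: measurableT_comp => //; exact: (measurable_fun_pair2 x mP).
    + by apply: emeasurable_funM.
    + by move=> y _; rewrite /= lee_fin /Phi/= normrM ler_wpM2l.
have fi : mu.-integrable setT (fun x => `|(EFin \o f) x|%E).
  by apply: integrable_abse => //; exact: rschwartz_integrable.
have /fineK <- := integrable_fin_num measurableT wi.
rewrite ge0_integralZr//; last 2 first.
- exact: measurable_int fi.
- by rewrite lee_fin fine_ge0// integral_ge0// => y _; rewrite lee_fin.
have /fineK <- := integrable_fin_num measurableT fi.
by rewrite -EFinM ltry.
Qed.

(** The split is made in the x-integral at fixed y, where each term is integrable by itself; in the
    y-integral the singularity of the kernel would prevent it. *)
Lemma Rintegral_mul_second_difference f g y : rschwartz f -> rschwartz g ->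
  mu.-integrable setT (EFin \o (fun x => f x * second_difference g x y)) /\
  (\int[mu]_x (f x * second_difference g x y) =
   2 * \int[mu]_x (f x * g x) - \int[mu]_x (f x * g (x + y))
   - \int[mu]_x (f x * g (x - y)))%R.
Proof.
move=> sf sg; have [M gM] := rschwartz_bounded sg.
have ifg z : mu.-integrable setT (EFin \o (fun x => f x * g (x + z))).
  apply: (@integrable_mul_bounded _ _ _ (fun x => g (x + z)) M) => //.
    exact: rschwartz_integrable.
  exact: (measurable_shift z (rschwartz_measurable sg)).
have i0 := integrableZR 2 (integrable_mul_rschwartz sf sg).
have -> : (fun x => f x * second_difference g x y) =
    (fun x => 2 * (f x * g x) - f x * g (x + y) - f x * g (x - y)).
  by apply/funext => x; rewrite /second_difference; ring.
have i1 := integrableBR i0 (ifg y).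
split; first exact: (integrableBR i1 (ifg (- y))).
rewrite (RintegralB measurableT i1 (ifg (- y))) (RintegralB measurableT i0 (ifg y)).
by rewrite RintegralZl//; exact: integrable_mul_rschwartz.
Qed.

(** Translation turns g(x+y) against f(x) into f(x-y) against g(x), and likewise with -y, so
    exchanging [f] and [g] merely swaps the two shifted terms. *)
Lemma Rintegral_second_difference_sym f g y : rschwartz f -> rschwartz g ->
  (\int[mu]_x (f x * second_difference g x y) =
   \int[mu]_x (g x * second_difference f x y))%R.
Proof.
move=> sf sg.
have [_ ->] := Rintegral_mul_second_difference y sf sg.
have [_ ->] := Rintegral_mul_second_difference y sg sf.
have mf := rschwartz_measurable sf; have mg := rschwartz_measurable sg.
have C (a b : 'rV[R]_n -> R) : (\int[mu]_x (a x * b x) = \int[mu]_x (b x * a x))%R.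
  by apply: eq_Rintegral => x _; rewrite mulrC.
rewrite (C f g) (Rintegral_shift_mul y mf mg) (Rintegral_shift_mul (- y) mf mg) opprK.
rewrite (C (fun x => f (x - y))) (C (fun x => f (x + y))).
by rewrite addrAC.
Qed.

Lemma rfrac_symmetric f g : rschwartz f -> rschwartz g ->
  mu.-integrable setT (EFin \o (fun x => f x * rfrac g x)) /\
  (\int[mu]_x (f x * rfrac g x) = \int[mu]_x (g x * rfrac f x))%R.
Proof.
move=> sf sg.
(* The inner y-integral of [Phi] is the function to be integrated, so its integrability is part of
   Fubini's theorem. *)
have PE a b : rschwartz b ->
    fubini_F mu (EFin \o Phi a b) = EFin \o (fun x => a x * rfrac b x).
  move=> sb; apply/funext => x; rewrite /fubini_F /=.
  have ig := integrable_second_difference x sb.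
  rewrite EFinM /rfrac /Rintegral fineK; last exact: integrable_fin_num.
  by rewrite -integralZl//; apply: eq_integral => y _; rewrite -EFinM.
split; first by rewrite -PE//; exact: (integrable_fubini_F (integrable_Phi sf sg)).
rewrite /Rintegral; congr fine.
have E a b : rschwartz a -> rschwartz b ->
  (\int[mu]_x (a x * rfrac b x)%:E = \int[mu]_y \int[mu]_x (Phi a b (x, y))%:E)%E.
  move=> sa sb; rewrite -(Fubini (integrable_Phi sa sb)).
  by apply: eq_integral => x _; have /(congr1 (@^~ x)) := PE a b sb.
rewrite !E//; apply: eq_integral => y _.
(* With y fixed the kernel is a constant and leaves the x-integral. *)
have PK a b : rschwartz a -> rschwartz b -> (\int[mu]_x (Phi a b (x, y))%:E =
    (K y)%:E * (\int[mu]_x (a x * second_difference b x y))%:E)%E.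
  move=> sa sb; have [iab _] := Rintegral_mul_second_difference y sa sb.
  rewrite /Rintegral fineK; last exact: integrable_fin_num.
  rewrite -integralZl//; apply: eq_integral => x _.
  by rewrite /Phi/= -EFinM; congr EFin; ring.
by rewrite !PK// (Rintegral_second_difference_sym y sf sg).
Qed.

End fractional_fubini.

(** * Reduction to real functions *)

Section complex_reduction.
Context {R : realType} {n : nat}.
Implicit Types (f g : 'rV[R]_n -> R) (u v : 'rV[R]_n -> R[i]) (x y : 'rV[R]_n).
Local Notation mu := (@lebesgue_rV R n).
Local Notation Re := (@complex.Re R).
Local Notation Im := (@complex.Im R).

Definition rfracLaplace (s : R) f x : R :=
  if s == 1 then - rlaplace f x else fracLaplace_const n s / 2 * rfrac s f x.

Lemma ReM_real (z : R[i]) (a : R) : Re (z * a%:C%C) = Re z * a.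
Proof. by case: z => b c /=; rewrite mulr0 subr0. Qed.

Lemma ImM_real (z : R[i]) (a : R) : Im (z * a%:C%C) = Im z * a.
Proof. by case: z => b c /=; rewrite mulr0 add0r. Qed.

(** The constant and the kernel are real, so taking real parts commutes with the operator. *)
Lemma Re_fracLaplace s u x : Re (fracLaplace s u x) = rfracLaplace s (Re \o u) x.
Proof.
rewrite /fracLaplace /rfracLaplace; case: ifP => _.
  rewrite raddfN; congr (- _); rewrite /laplace/rlaplace raddf_sum.
  exact: eq_bigr.
rewrite mulrC ReM_real mulrC; congr (_ * _); apply: eq_Rintegral => y _.
rewrite -fmorphV ReM_real; congr (_ * _).
by rewrite /second_difference !raddfB/= -[2]/(2%:R) !mulr_natl raddfMn.
Qed.

Lemma Im_fracLaplace s u x : Im (fracLaplace s u x) = rfracLaplace s (Im \o u) x.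
Proof.
rewrite /fracLaplace /rfracLaplace; case: ifP => _.
  rewrite raddfN; congr (- _); rewrite /laplace/rlaplace raddf_sum.
  exact: eq_bigr.
rewrite mulrC ImM_real mulrC; congr (_ * _); apply: eq_Rintegral => y _.
rewrite -fmorphV ImM_real; congr (_ * _).
by rewrite /second_difference !raddfB/= -[2]/(2%:R) !mulr_natl raddfMn.
Qed.

(** Integrability accompanies the identity because the complex product is later split into separate
    real integrals. *)
Lemma rfracLaplace_symmetric s f g : 0 < s -> s <= 1 ->
  rschwartz f -> rschwartz g ->
  mu.-integrable setT (EFin \o (fun x => f x * rfracLaplace s g x)) /\
  (\int[mu]_x (f x * rfracLaplace s g x) = \int[mu]_x (rfracLaplace s f x * g x))%R.
Proof.
move=> s0; rewrite le_eqVlt => /predU1P[->|s1] sf sg; rewrite /rfracLaplace.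
  rewrite eqxx.
  have [i1 e1] := rlaplace_symmetric sf sg; have [i2 _] := rlaplace_symmetric sg sf.
  have -> : (fun x => f x * - rlaplace g x) = (fun x => -1 * (f x * rlaplace g x)).
    by apply/funext => x; ring.
  have -> : (fun x => - rlaplace f x * g x) = (fun x => -1 * (g x * rlaplace f x)).
    by apply/funext => x; ring.
  split; first exact: (integrableZR (-1) i1).
  exact: (etrans (RintegralZl _ measurableT i1)
    (etrans (congr1 _ e1) (esym (RintegralZl _ measurableT i2)))).
rewrite lt_eqF//; set c := _ / 2.
have [i1 e1] := rfrac_symmetric s0 s1 sf sg; have [i2 _] := rfrac_symmetric s0 s1 sg sf.
have -> : (fun x => f x * (c * rfrac s g x)) = (fun x => c * (f x * rfrac s g x)).
  by apply/funext => x; ring.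
have -> : (fun x => c * rfrac s f x * g x) = (fun x => c * (g x * rfrac s f x)).
  by apply/funext => x; ring.
split; first exact: (integrableZR c i1).
exact: (etrans (RintegralZl _ measurableT i1)
  (etrans (congr1 _ e1) (esym (RintegralZl _ measurableT i2)))).
Qed.

End complex_reduction.

Unset Implicit Arguments.
Local Close Scope classical_set_scope.
Local Open Scope complex_scope.

Theorem lemma5p4 (R : realType) (n : nat) (s : R) (u v : 'rV[R]_n -> R[i])
    (n_ge1 : (1 <= n)%N) (s_gt0 : 0 < s) (s_le1 : s <= 1)
    (schwartz_u : schwartz u) (schwartz_v : schwartz v) :
  cintegral (lebesgue_rV n) (fun x => u x * fracLaplace s v x) =
  cintegral (lebesgue_rV n) (fun x => fracLaplace s u x * v x).
Proof.
have su1 := schwartz_Re schwartz_u; have su2 := schwartz_Im schwartz_u.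
have sv1 := schwartz_Re schwartz_v; have sv2 := schwartz_Im schwartz_v.
have S (f g : 'rV[R]_n -> R) (sf : rschwartz f) (sg : rschwartz g) :=
  (rfracLaplace_symmetric s_gt0 s_le1 sf sg).2.
have I (f g : 'rV[R]_n -> R) (sf : rschwartz f) (sg : rschwartz g) :=
  (rfracLaplace_symmetric s_gt0 s_le1 sf sg).1.
have I' (f g : 'rV[R]_n -> R) (sf : rschwartz f) (sg : rschwartz g) :
    (lebesgue_rV n).-integrable setT
      (EFin \o (fun x => rfracLaplace s f x * g x)).
  have := I g f sg sf; congr integrable.
  by apply/funext => x /=; rewrite mulrC.
have ReM (z w : R[i]) : complex.Re (z * w) =
    complex.Re z * complex.Re w - complex.Im z * complex.Im w.
  by case: z; case: w.
have ImM (z w : R[i]) : complex.Im (z * w) =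
    complex.Re z * complex.Im w + complex.Im z * complex.Re w.
  by case: z; case: w.
(* The real part is a difference of two real pairings and the imaginary part a sum of two; each
   pairing is symmetric by [S], while [I] and [I'] justify the splitting on either side. *)
rewrite /cintegral; congr (_ +i* _).
  under [LHS]eq_Rintegral do rewrite ReM Re_fracLaplace Im_fracLaplace.
  under [RHS]eq_Rintegral do rewrite ReM Re_fracLaplace Im_fracLaplace.
  rewrite (RintegralB measurableT (I _ _ su1 sv1) (I _ _ su2 sv2)).
  rewrite (RintegralB measurableT (I' _ _ su1 sv1) (I' _ _ su2 sv2)).
  by rewrite (S _ _ su1 sv1) (S _ _ su2 sv2).
under [LHS]eq_Rintegral do rewrite ImM Re_fracLaplace Im_fracLaplace.
under [RHS]eq_Rintegral do rewrite ImM Re_fracLaplace Im_fracLaplace.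
rewrite (RintegralD measurableT (I _ _ su1 sv2) (I _ _ su2 sv1)).
rewrite (RintegralD measurableT (I' _ _ su1 sv2) (I' _ _ su2 sv1)).
by rewrite (S _ _ su1 sv2) (S _ _ su2 sv1).
Qed.
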